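(* Let $\epsilon\in(0,1)$ and let $\mathbb P$ be a partially exchangeable probability distribution on $(\mathbb R^d\times\{-1,+1\})^{(k+1)N}$. With $\mathbb P$ probability at least $1-\epsilon$, for any $(w,b)\in\Theta$, $$\begin{aligned}\frac1{kN}&\sum_{i=N+1}^{(k+1)N}\mathbf 1\bigl\{2\,\mathbf 1[g_{w,b}(X_i)\ge0]-1\ne Y_i\bigr\}\\\le&\inf_{\lambda\in\mathbb R_+,\ h\in\mathbb N^*}\Biggl(\frac{k+1}{k}\bigl[1-\exp(-\tfrac\lambda N)\bigr]^{-1}\Biggl\{1-\exp\Biggl[-\frac{\lambda}{N^2}\sum_{i=1}^N\mathbf 1\bigl[g_{w,b}(X_i)Y_i\le4R\gamma_h\bigr]\\&-\frac{\log[20(k+1)N]\Bigl\{\frac{h}{\log(2)}\log\Bigl(\frac{4e(k+1)N}{h}\Bigr)+1\Bigr\}+\log\Bigl[\frac{2h(h+1)}{\epsilon}\Bigr]}{N}\Biggr]\Biggr\}-\frac1{kN}\sum_{i=1}^N\mathbf 1\bigl[g_{w,b}(X_i)Y_i\le4R\gamma_h\bigr]\Biggr).\end{aligned}$$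
   Context: $N,k,d\ge1$ are integers, $\Omega=(\mathbb R^d\times\{-1,+1\})^{(k+1)N}$ with coordinate process $(X_i,Y_i)_{i=1}^{(k+1)N}$. For $i=1,\dots,N$, $\tau_i:\Omega\to\Omega$ is defined by $\tau_i(\omega)_{i+jN}=\omega_{i+(j-1)N}$ for $j=1,\dots,k$, $\tau_i(\omega)_i=\omega_{i+kN}$, and $\tau_i(\omega)_{m+jN}=\omega_{m+jN}$ for $m\ne i$, $1\le m\le N$, $0\le j\le k$. $\mathbb P$ is partially exchangeable if $\mathbb P\circ\tau_i^{-1}=\mathbb P$ for all $i=1,\dots,N$. $\Theta=\{(w,b)\in\mathbb R^d\times\mathbb R:\|w\|=1\}$, $g_{w,b}(x)=\langle w,x\rangle-b$, and $R=\max\{\|X_i\|:1\le i\le(k+1)N\}$. For integers $h$, $\gamma_{2h}=(2h-1)^{-1/2}$ and $\gamma_{2h+1}=\bigl[2h\bigl(1-\frac1{(2h+1)^2}\bigr)\bigr]^{-1/2}$ (so $\gamma_1=+\infty$). $\mathbb N^*$ is the set of positive integers and $\mathbb R_+$ the set of nonnegative reals (in the infimum, $\lambda$ ranges over those values for which the expression is defined, i.e. $\lambda>0$).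
   Formalization: The infimum is taken over 1 ≤ h ≤ (k+1)N instead of all positive integers h, because as h tends to infinity h·log(4e(k+1)N/h) tends to −∞, so the printed infimum would be −∞ and the claim false. *)

(* Defs.v *)
From HB Require Import structures.
From mathcomp Require Import all_boot all_order all_algebra.
From mathcomp Require Import all_classical all_reals all_analysis.

Set Implicit Arguments.
Unset Strict Implicit.
Unset Printing Implicit Defensive.

Import Order.TTheory GRing.Theory Num.Theory.
Import numFieldNormedType.Exports.

Local Open Scope classical_set_scope.
Local Open Scope ring_scope.

(* Points of R^d are tuples, because tuples carry the product sigma-algebra in
   the library.  A label of {-1,+1} is a boolean, read through [sgn_label].
   Indices are 0-based: the index written i + jN in 1-based notation
   (1 <= i <= N, 0 <= j <= k) is here (i - 1) + j * N. *)
Definition Rvec (R : realType) (d : nat) := d.-tuple (measurableTypeR R).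

Definition sample (R : realType) (d k N : nat) :=
  (k.+1 * N).-tuple (Rvec R d * bool)%type.

Definition sgn_label (R : realType) (y : bool) : R := if y then 1 else -1.

Section PartialExchangeability.
Context (R : realType) (d k N : nat).

Definition pred_index (m : nat) : nat :=
  if (m < N)%N then (m + k * N)%N else (m - N)%N.

Lemma pred_index_lt (m : 'I_(k.+1 * N)) : (pred_index m < k.+1 * N)%N.
Proof.
rewrite /pred_index; case: ifP => mN.
  by rewrite [X in (_ < X)%N]mulSn ltn_add2r.
exact: leq_ltn_trans (leq_subr _ _) (ltn_ord m).
Qed.

Definition pred_ord (m : 'I_(k.+1 * N)) : 'I_(k.+1 * N) :=
  Ordinal (pred_index_lt m).

Definition tau (i : 'I_N) (s : sample R d k N) : sample R d k N :=
  [tuple if (m %% N == i)%N then tnth s (pred_ord m) else tnth s m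
    | m < k.+1 * N].

Definition partially_exchangeable (P : set (sample R d k N) -> \bar R) : Prop :=
  forall (i : 'I_N) (A : set (sample R d k N)),
    measurable A -> pushforward P (tau i) A = P A.

End PartialExchangeability.

(* The event [E] need not be measurable, so "with P-probability at least p" is
   understood as an inner probability. *)
Definition with_prob_ge (R : realType) (disp : measure_display)
    (T : measurableType disp) (P : probability T R) (p : R) (E : set T) : Prop :=
  exists A : set T, [/\ measurable A, A `<=` E & (p%:E <= P A)%E].

Section MarginBound.
Context (R : realType) (d : nat).

Definition dotp (w x : Rvec R d) : R := \sum_(i < d) tnth w i * tnth x i.

Definition enorm (x : Rvec R d) : R := Num.sqrt (dotp x x).

Definition Theta : set (Rvec R d * R) := [set wb | enorm wb.1 = 1].

Definition affine (wb : Rvec R d * R) (x : Rvec R d) : R :=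
  dotp wb.1 x - wb.2.

Definition gamma_margin (n : nat) : \bar R :=
  let h := n./2 in
  if odd n then
    if h == 0%N then +oo%E
    else ((Num.sqrt (2 * h%:R * (1 - 1 / (2 * h%:R + 1) ^+ 2)))^-1)%:E
  else ((Num.sqrt (2 * h%:R - 1))^-1)%:E.

Context (k N : nat).
Implicit Types (s : sample R d k N) (wb : Rvec R d * R).

Definition obsX s (i : 'I_(k.+1 * N)) : Rvec R d := (tnth s i).1.

Definition obsY s (i : 'I_(k.+1 * N)) : R := sgn_label R (tnth s i).2.

Definition max_norm s : R := \big[Order.max/0]_(i < k.+1 * N) enorm (obsX s i).

Definition test_error s wb : R :=
  (k * N)%:R^-1 * \sum_(i < k.+1 * N | (N <= i)%N)
    (2 * (0 <= affine wb (obsX s i))%R%:R - 1 != obsY s i)%:R.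

(* When all the X_i vanish and h = 1, the threshold is 0 * +oo = 0. *)
Definition margin_errors s wb (h : nat) : R :=
  \sum_(i < k.+1 * N | (i < N)%N)
    (((affine wb (obsX s i) * obsY s i)%:E
      <= (4 * max_norm s)%:E * gamma_margin h)%E)%:R.

Definition complexity (epsilon : R) (h : nat) : R :=
  let n : R := (k.+1 * N)%:R in
  ln (20 * n) * (h%:R / ln 2 * ln (4 * expR 1 * n / h%:R) + 1)
  + ln (2 * h%:R * (h%:R + 1) / epsilon).

Definition bound_at (epsilon : R) s wb (lambda : R) (h : nat) : R :=
  k.+1%:R / k%:R * (1 - expR (- (lambda / N%:R)))^-1
    * (1 - expR (- (lambda / N%:R ^+ 2 * margin_errors s wb h)
                 - complexity epsilon h / N%:R))
  - (k * N)%:R^-1 * margin_errors s wb h.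

(* h ranges over 1 <= h <= (k + 1) N, where the Sauer-type estimate behind
   [complexity] is valid.  This range is a restriction with respect to all
   positive h: as h tends to infinity, [complexity] tends to -oo, hence so does
   [bound_at], and the infimum over all positive h would be -oo. *)
Definition margin_bound (epsilon : R) s wb : \bar R :=
  ereal_inf [set b | exists (lambda : R) (h : nat),
    [/\ 0 < lambda, (0 < h <= k.+1 * N)%N
      & b = (bound_at epsilon s wb lambda h)%:E]].

End MarginBound.

(* Main.v *)
Require Import Defs.
From HB Require Import structures.
From mathcomp Require Import all_boot all_order all_algebra.
From mathcomp Require Import all_classical all_reals all_analysis.
From mathcomp Require Import measurable_realfun ring lra zify.

(** Margins enter through sample compression.  Normalise labelled points by
    appending two coordinates of size [max_norm], one for the bias and one for
    the margin shift.  A classifier of [Theta] then becomes a linear functional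
    that separates, with relative margin of order [1 / sqrt h], the points it
    misclassifies from the points lying outside the margin
    [4 * max_norm * gamma_margin h].  By Novikoff's theorem the perceptron
    separates the same points after at most [3 * h] updates ([perceptron]).  So
    every classifier comes with a pattern of errors, lying between its actual
    errors and its margin errors, that is encoded by a word of length [3 * h]
    over signed sample indices ([pattern_cover]).  With [n] the sample size and
    two more codes for classifiers that are constant on the sample, there are
    only [2 + (2n+1)^(3h)] codes, which [complexity] dominates
    ([card_code_complexity]).

    For one fixed pattern, apply a uniform random rotation in each of the [N]
    blocks.  The training errors become a sum of independent Bernoulli
    variables, and their Laplace transform is bounded by that of a binomial law
    through the inequality between arithmetic and geometric means
    ([sum_expR_rotate]).  Markov's inequality bounds the fraction of rotations
    with a large deviation, for all parameters [lambda] at once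
    ([rotation_deviation]).  A rotation of the sample permutes the family of
    patterns, so the union bound over codes may be taken inside an orbit, and
    partial exchangeability turns fractions of orbits into probabilities
    ([orbit_fraction_bound]).  The weights [1 / (h (h+1))] sum to at most one.

    There remains to pass from a pattern to the actual numbers of test errors
    and margin errors.  The bound is not monotone in the number of margin
    errors, but it is concave, and it is trivial when all training points are
    margin errors ([margin_count_interpolation]). *)

Set Implicit Arguments.
Unset Strict Implicit.
Unset Printing Implicit Defensive.

Import Order.TTheory GRing.Theory Num.Theory.
Import numFieldNormedType.Exports.

Local Open Scope classical_set_scope.
Local Open Scope ring_scope.

(** * The perceptron *)

Definition dprod (R : realFieldType) (D : finType) (u v : D -> R) : R :=
  \sum_(d : D) u d * v d.

Lemma dprodC (R : realFieldType) (D : finType) (u v : D -> R) :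
  dprod u v = dprod v u.
Proof. by apply: eq_bigr => d _; rewrite mulrC. Qed.

Lemma dprodDr (R : realFieldType) (D : finType) (u v w : D -> R) :
  dprod u (v \+ w) = dprod u v + dprod u w.
Proof. by rewrite -big_split; apply: eq_bigr => d _; rewrite mulrDr. Qed.

Lemma dprodDD (R : realFieldType) (D : finType) (u v : D -> R) :
  dprod (u \+ v) (u \+ v) = dprod u u + 2 * dprod v u + dprod v v.
Proof.
by rewrite /dprod mulr_sumr -!big_split; apply: eq_bigr => d _ /=; ring.
Qed.

Lemma dprodZr (R : realFieldType) (D : finType) (a : R) (u v : D -> R) :
  dprod u (a \*o v) = a * dprod u v.
Proof. by rewrite mulr_sumr; apply: eq_bigr => d _ /=; ring. Qed.

Lemma dprod0 (R : realFieldType) (D : finType) (u : D -> R) :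
  dprod u (fun=> 0) = 0.
Proof. by apply: big1 => d _; rewrite mulr0. Qed.

Lemma dprod_ge0 (R : realFieldType) (D : finType) (u : D -> R) :
  0 <= dprod u u.
Proof. by apply: sumr_ge0 => d _; rewrite -expr2 sqr_ge0. Qed.

Lemma dprod_sumr (R : realFieldType) (D : finType) (T : Type) (c : seq T)
    (u : D -> R) (f : T -> D -> R) :
  dprod u (fun d => \sum_(x <- c) f x d) = \sum_(x <- c) dprod u (f x).
Proof.
rewrite /dprod exchange_big; apply: eq_bigr => d _ /=.
by rewrite mulr_sumr.
Qed.

Lemma dprod_CauchySchwarz (R : realFieldType) (D : finType) (u v : D -> R) :
  dprod u v ^+ 2 <= dprod u u * dprod v v.
Proof.
set a := dprod u u; set b := dprod u v; set c := dprod v v.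
have quad t : 0 <= a + 2 * t * b + t ^+ 2 * c.
  apply: le_trans (dprod_ge0 (u \+ (t \*o v))) _.
  rewrite dprodDD dprodZr (dprodC _ u) (dprodC _ v) !dprodZr.
  by rewrite -/a -/b -/c; lra.
have a0 : 0 <= a := dprod_ge0 u.
have := dprod_ge0 v; rewrite -/c le_eqVlt => /predU1P[c0|c0].
  have [->|b0] := eqVneq b 0; first by rewrite expr0n/= mulr_ge0// -c0.
  have := quad (- (a + 1) / (2 * b)); rewrite -c0 mulr0 addr0.
  have -> : 2 * (- (a + 1) / (2 * b)) * b = - (a + 1) by field.
  by lra.
have := quad (- b / c).
have -> : a + 2 * (- b / c) * b + (- b / c) ^+ 2 * c = (a * c - b ^+ 2) / c.
  by field; lra.
by rewrite pmulr_lge0 ?invr_gt0// subr_ge0.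
Qed.

(** [None] is padding: it gives all runs of the perceptron words of one common
    length. *)
Definition letter_vec (R : realFieldType) (I : Type) (D : Type)
    (Z : I -> D -> R) (x : option (I * bool)) : D -> R :=
  match x with
  | None => fun=> 0
  | Some (i, b) => (if b then 1 else -1) \*o Z i
  end.

Definition run_vec (R : realFieldType) (I : Type) (D : Type)
    (Z : I -> D -> R) (c : seq (option (I * bool))) : D -> R :=
  fun d => \sum_(x <- c) letter_vec Z x d.

Lemma run_vec_cons (R : realFieldType) (I : Type) (D : Type)
    (Z : I -> D -> R) x c :
  run_vec Z (x :: c) = letter_vec Z x \+ run_vec Z c.
Proof. by apply/funext => d; rewrite /run_vec big_cons. Qed.

Definition separates (R : realFieldType) (I : Type) (D : finType)
    (Z : I -> D -> R) (pos neg : I -> Prop) (V : D -> R) : Prop :=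
  forall i, (pos i -> 0 < dprod V (Z i)) /\ (neg i -> dprod V (Z i) <= 0).

(** Novikoff's argument: each update on a misclassified vector raises
    [dprod W V] by at least the margin [theta] and [dprod V V] by at most
    [B], and the Cauchy-Schwarz inequality stops this after [m] updates.
    Only the indices of the updates are needed to recover the separating
    vector; this is what makes the perceptron a compression scheme. *)
Lemma perceptron (R : realFieldType) (I : Type) (D : finType)
    (Z : I -> D -> R) (W : D -> R) (pos neg : I -> Prop) (theta B : R) (m : nat) :
  0 < theta ->
  (forall i, pos i -> theta <= dprod W (Z i)) ->
  (forall i, neg i -> dprod W (Z i) <= - theta) ->
  (forall i, dprod (Z i) (Z i) <= B) ->
  dprod W W * B <= m%:R * theta ^+ 2 ->
  exists2 c : seq (option (I * bool)),
    size c = m & separates Z pos neg (run_vec Z c).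
Proof.
move=> theta0 hpos hneg hB hm.
pose inv t V := t%:R * theta <= dprod W V /\ dprod V V <= t%:R * B.
have upd t c : ~ separates Z pos neg (run_vec Z c) -> inv t (run_vec Z c) ->
    exists i b, inv t.+1 (run_vec Z (Some (i, b) :: c)).
  move=> nsep [hW hV].
  have [i [b [hb1 hb2]]] : exists i b,
      theta <= dprod W (letter_vec Z (Some (i, b))) /\
      dprod (run_vec Z c) (letter_vec Z (Some (i, b))) <= 0.
    apply/not_existsP => nb; apply: nsep => i; split=> hi.
      rewrite ltNge; apply/negP => V0; apply: (nb i); exists true.
      by rewrite !dprodZr !mul1r; split=> //; exact: hpos.
    rewrite leNgt; apply/negP => V0; apply: (nb i); exists false.
    by rewrite !dprodZr; have := hneg _ hi; split; lra.
  exists i, b; rewrite run_vec_cons /inv.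
  have zz : dprod (letter_vec Z (Some (i, b))) (letter_vec Z (Some (i, b)))
      <= B.
    rewrite dprodZr dprodC dprodZr mulrA; have := hB i.
    by case: (b) => /=; rewrite ?mulrNN !mul1r.
  by rewrite dprodDr dprodDD -natr1; split; lra.
have run t : exists2 c : seq (option (I * bool)), size c = t &
    separates Z pos neg (run_vec Z c) \/ inv t (run_vec Z c).
  elim: t => [|t [c sc [sep|hinv]]].
  - exists [::] => //; right; rewrite /inv.
    have -> : run_vec Z [::] = fun=> 0.
      by apply/funext => d; rewrite /run_vec big_nil.
    by rewrite !dprod0 !mul0r.
  - exists (None :: c); rewrite /= ?sc//; left; rewrite run_vec_cons.
    by have -> : letter_vec Z None \+ run_vec Z c = run_vec Z c
      by apply/funext => d; rewrite /= add0r.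
  - have [sep|nsep] := pselect (separates Z pos neg (run_vec Z c)).
      exists (None :: c); rewrite /= ?sc//; left; rewrite run_vec_cons.
      by have -> : letter_vec Z None \+ run_vec Z c = run_vec Z c
        by apply/funext => d; rewrite /= add0r.
    have [i [b hib]] := upd _ _ nsep hinv.
    by exists (Some (i, b) :: c); rewrite /= ?sc//; right.
have [c sc [sep|hinv]] := run m; first by exists c.
exists c => //; apply: contrapT => nsep.
have [i [b [hW hV]]] := upd _ _ nsep hinv.
move: hW hV; set V := run_vec _ _ => hW hV.
have W0 := dprod_ge0 W; have CS := dprod_CauchySchwarz W V.
have t0 : 0 < m.+1%:R * theta by rewrite mulr_gt0.
have le1 : (m.+1%:R * theta) ^+ 2 <= dprod W V ^+ 2.
  by rewrite ler_sqr ?nnegrE ?(ltW t0)// (le_trans (ltW t0)).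
have le2 : dprod W W * dprod V V <= m.+1%:R * (dprod W W * B).
  by rewrite mulrCA ler_wpM2l.
have le3 : m.+1%:R * (dprod W W * B) <= m.+1%:R * (m%:R * theta ^+ 2).
  by rewrite ler_wpM2l.
have := le_trans le1 (le_trans CS (le_trans le2 le3)).
rewrite exprMn expr2 -mulrA ler_pM2l// ler_pM2r ?exprn_gt0//.
by rewrite ler_nat ltnn.
Qed.

(** * Blockwise rotations of the sample *)

Section Rotations.
Variables k N : nat.
Implicit Types (m : 'I_(k.+1 * N)) (g : {ffun 'I_N -> 'I_k.+1}).

Lemma block_gt0 m : (0 < N)%N.
Proof. by case: N m => // -[m]; rewrite muln0. Qed.

Lemma block_row_lt m : (m %/ N < k.+1)%N.
Proof. by rewrite ltn_divLR ?(block_gt0 m). Qed.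

Lemma block_col_lt m : (m %% N < N)%N.
Proof. by rewrite ltn_mod (block_gt0 m). Qed.

Lemma block_index_lt (j : 'I_k.+1) (i : 'I_N) : (i + j * N < k.+1 * N)%N.
Proof.
apply: (@leq_trans (j.+1 * N)); first by rewrite mulSn ltn_add2r.
by rewrite leq_mul2r orbC ltn_ord.
Qed.

Definition block_row m : 'I_k.+1 := Ordinal (block_row_lt m).
Definition block_col m : 'I_N := Ordinal (block_col_lt m).
Definition block_index (j : 'I_k.+1) (i : 'I_N) : 'I_(k.+1 * N) :=
  Ordinal (block_index_lt j i).

Lemma block_rowK j i : block_row (block_index j i) = j.
Proof.
apply: val_inj => /=; have iN := ltn_ord i.
by rewrite addnC divnMDl ?(leq_ltn_trans _ iN)// divn_small ?addn0.
Qed.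

Lemma block_colK j i : block_col (block_index j i) = i.
Proof. by apply: val_inj => /=; rewrite addnC modnMDl modn_small. Qed.

Lemma block_indexK m : block_index (block_row m) (block_col m) = m.
Proof. by apply: val_inj => /=; rewrite addnC -divn_eq. Qed.

Lemma sum_block (R : nmodType) (F : 'I_(k.+1 * N) -> R) :
  \sum_m F m = \sum_(i < N) \sum_(j < k.+1) F (block_index j i).
Proof.
rewrite pair_big /= (reindex (fun p => block_index p.2 p.1)) //=.
exists (fun m => (block_col m, block_row m)) => [[i j] _|m _] /=.
  by rewrite block_rowK block_colK.
exact: block_indexK.
Qed.

Lemma sum_block0 (R : nmodType) (F : 'I_(k.+1 * N) -> R) :
  \sum_(m < k.+1 * N | (m < N)%N) F m = \sum_(i < N) F (block_index 0 i).
Proof.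
rewrite (reindex (block_index 0)) /=.
  by apply: eq_bigl => i; rewrite /= addn0 ltn_ord.
exists block_col => [i _|m]; first exact: block_colK.
rewrite inE => mN; apply: val_inj => /=.
by rewrite mul0n addn0 modn_small.
Qed.

(** Cell [j] of block [i] receives the observation of cell [j - g i]: all powers
    and products of the maps [tau i] have this form. *)
Definition rotate g m : 'I_(k.+1 * N) :=
  block_index (block_row m - g (block_col m)) (block_col m).

Lemma rotate0 m : rotate 0 m = m.
Proof. by rewrite /rotate ffunE subr0 block_indexK. Qed.

Lemma rotateD g g' m : rotate (g + g') m = rotate g (rotate g' m).
Proof. by rewrite /rotate block_rowK block_colK ffunE opprD addrA addrAC. Qed.

Lemma rotate_bij g : bijective (rotate g).
Proof.
by exists (rotate (- g)) => m; rewrite -rotateD ?subrr ?addNr rotate0.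
Qed.

Definition unit_rotation (i : 'I_N) : {ffun 'I_N -> 'I_k.+1} :=
  [ffun i' => if i' == i then Zp1 else 0].

Lemma rotate_unit i m :
  rotate (unit_rotation i) m = if (m %% N == i)%N then pred_ord m else m.
Proof.
rewrite /rotate ffunE; have -> : (block_col m == i) = (m %% N == i)%N by [].
case: eqP => [mi|_]; last by rewrite subr0 block_indexK.
apply: val_inj; rewrite /= /pred_index.
have N0 := block_gt0 m; have hm := divn_eq m N; have qk := block_row_lt m.
have -> : (m < N)%N = (m %/ N == 0)%N.
  by rewrite -leqn0 -[RHS]ltnS ltn_divLR// mul1n.
have pred_mod K q : (q < K.+1)%N ->
    ((q + (K.+1 - 1 %% K.+1) %% K.+1) %% K.+1)%N = if q == 0%N then K else q.-1.
  case: K => [|K] qK; first by rewrite modn1; move: qK; rewrite ltnS leqn0 => ->.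
  rewrite (modn_small (m := 1))// subSS subn0 (modn_small (m := K.+1))//.
  case: q qK => [|q] qK /=; first by rewrite modn_small.
  by rewrite addSnnS modnDr modn_small// ltnW.
rewrite pred_mod//.
case: (m %/ N)%N hm => [|q] /= hm; first by rewrite [in RHS]hm mul0n.
by rewrite [in RHS]hm (mulSn q) -addnA addKn addnC.
Qed.

Lemma unit_rotations_generate (Q : {ffun 'I_N -> 'I_k.+1} -> Prop) :
  Q 0 -> (forall g i, Q g -> Q (g + unit_rotation i)) -> forall g, Q g.
Proof.
move=> Q0 QS g.
have Qn g' i n : Q g' -> Q (g' + unit_rotation i *+ n).
  elim: n => [|n IH] Qg'; first by rewrite addr0.
  by rewrite mulrSr addrA; exact/QS/IH.
have -> : g = \sum_(i < N) unit_rotation i *+ g i.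
  apply/ffunP => i; rewrite sum_ffunE (bigD1 i)//= big1 ?addr0.
    have -> n : (unit_rotation i *+ n) i = Zp1 *+ n.
      by elim: n => [|n IH]; rewrite ?ffunE// !mulrS ffunE IH ffunE eqxx.
    rewrite Zp_mulrn; apply: val_inj => /=.
    by rewrite modnMml mul1n modn_small.
  move=> i' i'i; elim: (nat_of_ord (g i')) => [|n IH]; first by rewrite ffunE.
  by rewrite mulrS ffunE IH ffunE eq_sym (negbTE i'i) addr0.
elim: (index_enum _) => [|i s IH]; first by rewrite big_nil.
by rewrite big_cons addrC; exact: Qn.
Qed.

Definition train_count (p : 'I_(k.+1 * N) -> bool) : nat :=
  (\sum_(m < k.+1 * N | (m < N)%N) p m)%N.

Definition total_count (p : 'I_(k.+1 * N) -> bool) : nat :=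
  (\sum_(m < k.+1 * N) p m)%N.

Lemma total_count_rotate g (p : 'I_(k.+1 * N) -> bool) :
  total_count (p \o rotate g) = total_count p.
Proof.
rewrite /total_count [RHS](reindex (rotate g))//.
exact/onW_bij/rotate_bij.
Qed.

End Rotations.

Arguments unit_rotation {k N} i.

(** * Deviations along an orbit of rotations *)

Section OrbitDeviation.
Variables (R : realType) (k N : nat).
Hypothesis N_gt0 : (0 < N)%N.
Implicit Types (a C : R) (p : 'I_(k.+1 * N) -> bool).
Implicit Types (g : {ffun 'I_N -> 'I_k.+1}).

Definition mean_laplace a p : R :=
  1 - (1 - expR (- a)) * ((total_count p)%:R / (k.+1 * N)%:R).

(** The parameter is chosen after the pattern is seen: no union bound is paid
    for the infimum over [lambda] in the theorem. *)
Definition deviates C p : Prop :=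
  exists2 a, 0 < a &
    mean_laplace a p ^+ N * expR C < expR (- (a * (train_count p)%:R)).

(** Up to the factor that counts rotations, the left-hand side is the Laplace
    transform of the training errors when one observation is drawn uniformly
    and independently from each block.  It factors over blocks, and the
    geometric mean of the factors is at most their arithmetic mean, which
    depends on the total count only. *)
Lemma sum_expR_rotate a p :
  \sum_g expR (- (a * (train_count (p \o rotate g))%:R))
  <= #|{ffun 'I_N -> 'I_k.+1}|%:R * mean_laplace a p ^+ N.
Proof.
pose F (i : 'I_N) (j : 'I_k.+1) := expR (- (a * (p (block_index j i))%:R)).
have laplaceE g : expR (- (a * (train_count (p \o rotate g))%:R))
    = \prod_i F i (- g i).
  rewrite /train_count sum_block0 natr_sum mulr_sumr -sumrN expR_sum.
  by apply: eq_bigr => i _; rewrite /F /= /rotate block_rowK block_colK sub0r.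
rewrite (eq_bigr _ (fun g _ => laplaceE g)).
rewrite -(bigA_distr_bigA (fun i j => F i (- j))).
pose E i : R := k.+1%:R - (1 - expR (- a)) * (\sum_j p (block_index j i))%N%:R.
have FE i : \sum_j F i (- j) = E i.
  have -> : \sum_j F i (- j) = \sum_j F i j.
    by rewrite [RHS](reindex_inj oppr_inj).
  rewrite /E natr_sum mulr_sumr.
  have -> : k.+1%:R = \sum_(j < k.+1) (1 : R) by rewrite sumr_const card_ord.
  rewrite -sumrB; apply: eq_bigr => j _; rewrite /F.
  by case: (p _); rewrite ?mulr1 ?mulr0 ?oppr0 ?expR0; ring.
rewrite (eq_bigr _ (fun i _ => FE i)).
have E0 i : 0 <= E i by rewrite -FE; apply: sumr_ge0 => j _; exact: expR_ge0.
have [AGM _] := @leif_AGM _ _ 'I_N E (fun i _ => E0 i).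
apply: le_trans AGM _.
have -> : (#|{ffun 'I_N -> 'I_k.+1}|)%:R = k.+1%:R ^+ N :> R.
  by rewrite card_ffun !card_ord natrX.
rewrite -exprMn card_ord.
have -> : (\sum_i E i) / N%:R = k.+1%:R * mean_laplace a p.
  rewrite sumrB sumr_const card_ord -mulr_sumr -natr_sum.
  rewrite -(sum_block (fun m => p m : nat)) -/(total_count p) /mean_laplace natrM.
  have N0 : N%:R != 0 :> R by rewrite pnatr_eq0 -lt0n.
  rewrite -mulr_natr; field.
  by rewrite N0 nat1r pnatr_eq0.
by [].
Qed.

(** The parameter [a] that witnesses a deviation depends on the pattern.
    All patterns of an orbit share their total count, so the witness for the
    deviating pattern of largest training count works for the whole orbit, and
    Markov's inequality applies with that single parameter. *)
Lemma rotation_deviation C p :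
  #|[pred g | `[< deviates C (p \o rotate g) >]]|%:R
  <= expR (- C) * #|{ffun 'I_N -> 'I_k.+1}|%:R :> R.
Proof.
set bad := [pred g | _].
have [g0 bad0|nobad] := pickP bad; last first.
  by rewrite (eq_card0 nobad) mulr_ge0// expR_ge0.
case: (arg_maxnP (fun g => train_count (p \o rotate g)) bad0) => gM.
move=> /asboolP [a a0]; rewrite /mean_laplace total_count_rotate.
rewrite -/(mean_laplace a p) => aM maxM.
set L := mean_laplace a p ^+ N.
have e1 : 0 < expR (- a) < 1 by rewrite expR_gt0 -expR0 ltr_expR oppr_lt0.
have L0 : 0 < L.
  rewrite exprn_gt0// subr_gt0.
  have n0 : 0 < (k.+1 * N)%:R :> R by rewrite ltr0n muln_gt0.
  rewrite mulrA ltr_pdivrMr// mul1r.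
  have : (total_count p)%:R <= (k.+1 * N)%:R :> R.
    rewrite ler_nat -[leqRHS]card_ord -sum1_card.
    by apply: leq_sum => m _; exact: leq_b1.
  have : 0 <= (total_count p)%:R :> R by [].
  by nra.
rewrite -(ler_pM2r L0) -(ler_pM2r (expR_gt0 C)).
have -> (G : R) : expR (- C) * G * L * expR C = G * L.
  by rewrite -[RHS]mul1r -(expR0 R) -[in RHS](addNr C) expRD; ring.
apply: le_trans (sum_expR_rotate a p).
rewrite [leRHS](bigID bad) /= -mulrA.
apply: (@le_trans _ _ (\sum_(g | bad g)
    expR (- (a * (train_count (p \o rotate g))%:R)))).
  rewrite -sumr_const mulr_suml; apply: ler_sum => g badg.
  rewrite mul1r; apply: le_trans (ltW aM) _.
  by rewrite ler_expR lerN2 ler_pM2l// ler_nat; exact: maxM.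
by rewrite lerDl; apply: sumr_ge0 => g _; exact: expR_ge0.
Qed.

End OrbitDeviation.

(** * Averaging a probability over an orbit *)

Section Averaging.
Variables (R : realType) (d k N : nat).
Implicit Types (s : sample R d k N) (f : 'I_(k.+1 * N) -> 'I_(k.+1 * N)).

Definition permute f s : sample R d k N := [tuple tnth s (f m) | m < k.+1 * N].

Lemma measurable_permute f : measurable_fun setT (permute f).
Proof.
apply/measurable_fun_tnthP => m.
have -> : (@tnth (k.+1 * N) _)^~ m \o permute f = (@tnth _ _)^~ (f m).
  by apply/funext => s /=; rewrite tnth_mktuple.
exact: measurable_tnth.
Qed.

Lemma measurable_preimage_permute f (A : set (sample R d k N)) :
  measurable A -> measurable (permute f @^-1` A).
Proof.
by move=> mA; rewrite -[X in measurable X]setTI; exact: measurable_permute.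
Qed.

Lemma tau_permute (i : 'I_N) : @tau R d k N i = permute (rotate (unit_rotation i)).
Proof.
apply/funext => s; apply: eq_from_tnth => m.
by rewrite !tnth_mktuple rotate_unit; case: ifP.
Qed.

Variable P : probability (sample R d k N) R.
Hypothesis P_exch : partially_exchangeable P.

Lemma partially_exchangeable_rotate g (A : set (sample R d k N)) :
  measurable A -> P (permute (rotate g) @^-1` A) = P A.
Proof.
elim/unit_rotations_generate: g A => [|g i IH] A mA.
  congr (P _); apply/funext => s; rewrite /preimage/=; congr (A _).
  by apply: eq_from_tnth => m; rewrite tnth_mktuple rotate0.
rewrite -(IH _ mA) -[RHS](P_exch i); last exact: measurable_preimage_permute.
rewrite /pushforward tau_permute; congr (P _).
apply/funext => s; rewrite /preimage/=; congr (A _).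
by apply: eq_from_tnth => m; rewrite !tnth_mktuple addrC rotateD.
Qed.

(** By invariance [P U] is the mean over [g] of the probabilities of the rotated
    copies of [U], hence the expectation of the fraction of rotations that send
    the sample into [U]. *)
Lemma orbit_fraction_bound (U : set (sample R d k N)) (c : R) :
  measurable U ->
  (forall s, #|[pred g | `[< U (permute (rotate g) s) >]]|%:R
    <= c * #|{ffun 'I_N -> 'I_k.+1}|%:R) ->
  (P U <= c%:E)%E.
Proof.
move=> mU hU; set G := #|{ffun 'I_N -> 'I_k.+1}|.
have G0 : 0 < G%:R :> R by rewrite ltr0n /G card_ffun !card_ord expn_gt0.
pose V g := permute (rotate g) @^-1` U.
have mV g : measurable (V g) by exact: measurable_preimage_permute.
have sumP : (\sum_(g : {ffun 'I_N -> 'I_k.+1}) P U)%E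
    = (\int[P]_s (\sum_g (\1_(V g) s)%:E))%E.
  rewrite ge0_integral_sum//.
  - apply: eq_bigr => g _; rewrite integral_indic// setIT.
    exact/esym/partially_exchangeable_rotate.
  - by move=> g; exact/measurable_EFinP/measurable_indic.
have le_int : (\int[P]_s (\sum_g (\1_(V g) s)%:E) <= (c * G%:R)%:E)%E.
  rewrite -[leRHS]mule1 -(@probability_setT _ _ _ P) -integral_cst//.
  apply: ge0_le_integral => //=.
  - by move=> s _; apply: sume_ge0 => g _; rewrite lee_fin.
  - by apply: emeasurable_sum => g; exact/measurable_EFinP/measurable_indic.
  - move=> s _; rewrite sumEFin lee_fin; apply: le_trans (hU s).
    rewrite -sum1_card natr_sum [leRHS]big_mkcond /=; apply: ler_sum => g _.
    rewrite indicE /V /preimage; case: ifPn => [_|/asboolPn nU].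
      by case: (_ \in _).
    by rewrite memNset.
have : (\sum_(g : {ffun 'I_N -> 'I_k.+1}) P U <= (c * G%:R)%:E)%E.
  by rewrite sumP.
have /fineK <- : P U \is a fin_num by exact: fin_num_measure.
rewrite sumEFin !lee_fin sumr_const -[X in _ *+ X]/G -[_ *+ G]mulr_natr.
by rewrite ler_pM2r.
Qed.

End Averaging.

(** * Error patterns *)

Section Patterns.
Variables (R : realType) (d k N : nat).
Implicit Types (s : sample R d k N) (i : 'I_(k.+1 * N)).
Implicit Types (wb : Rvec R d * R) (h : nat).

(** The labelled point with two more coordinates: the label again, which carries
    the bias, and a constant, which carries the margin shift.  The scale
    [max_norm] keeps the square norm at most three times [max_norm ^+ 2]. *)
Definition feature s i (x : 'I_d + bool) : R :=
  match x with
  | inl j => obsY s i * tnth (obsX s i) j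
  | inr b => (if b then obsY s i else 1) * max_norm s
  end.

(** The words are perceptron runs.  The two extra codes serve the classifiers
    that are constant on the sample, whose bias can be arbitrarily large
    compared with [max_norm]. *)
Definition code h : finType :=
  (bool + (3 * h).-tuple (option ('I_(k.+1 * N) * bool)))%type.

Definition pattern h s (c : code h) i : bool :=
  match c with
  | inl b => (tnth s i).2 == b
  | inr t => dprod (run_vec (feature s) t) (feature s i) <= 0
  end.

(** A permutation of the sample does not preserve the pattern of a given code;
    it permutes the family of all patterns, by acting on the indices that occur
    in codes. *)
Definition relabel h (f : 'I_(k.+1 * N) -> 'I_(k.+1 * N)) (c : code h) :
    code h :=
  match c with
  | inl b => inl b
  | inr t => inr (map_tuple (omap (fun x => (f x.1, x.2))) t)
  end.

Lemma max_norm_permute f s : bijective f -> max_norm (permute f s) = max_norm s.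
Proof.
move=> [f' fK f'K].
have norm_permute i : enorm (obsX (permute f s) i) = enorm (obsX s (f i)).
  by rewrite /obsX tnth_mktuple.
apply/le_anti/andP; split; apply: bigmax_le => [|i _].
- exact: bigmax_ge_id.
- by rewrite norm_permute; exact: (le_bigmax _ (fun i => enorm (obsX s i))).
- exact: bigmax_ge_id.
- rewrite -(f'K i) -norm_permute.
  exact: (le_bigmax _ (fun i => enorm (obsX (permute f s) i))).
Qed.

Lemma pattern_permute h f s (c : code h) i :
  bijective f -> pattern (permute f s) c i = pattern s (relabel f c) (f i).
Proof.
move=> fbij; case: c => [b|t] /=; first by rewrite tnth_mktuple.
have fE j : feature (permute f s) j = feature s (f j).
  apply/funext => -[l|b]; rewrite /feature ?(max_norm_permute _ fbij);
  by rewrite /obsX /obsY tnth_mktuple.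
rewrite fE; congr (dprod _ _ <= 0); apply/funext => x.
rewrite /run_vec big_map; apply: eq_bigr => -[[j b]|] _ //=.
by rewrite fE.
Qed.

Lemma measurable_obsY i : measurable_fun setT (fun s => obsY s i).
Proof.
apply: measurable_fun_ifT => //.
apply: (@measurableT_comp _ _ _ _ _ _ snd) => //.
exact: measurable_tnth.
Qed.

Lemma measurable_obsX i (j : 'I_d) :
  measurable_fun setT (fun s => tnth (obsX s i) j).
Proof.
apply: (@measurableT_comp _ _ _ _ _ _ (fun x : Rvec R d => tnth x j)).
  exact: measurable_tnth.
apply: (@measurableT_comp _ _ _ _ _ _ fst) => //.
exact: measurable_tnth.
Qed.

Lemma measurable_max_norm : measurable_fun setT (@max_norm R d k N).
Proof.
rewrite /max_norm; elim: (index_enum _) => [|i r IH].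
  rewrite (_ : (fun _ => _) = cst 0); first exact: measurable_cst.
  by apply/funext => s; rewrite big_nil.
rewrite (_ : (fun _ => _) = (fun s => enorm (obsX s i)) \max
    (fun s => \big[Order.max/0]_(j <- r) enorm (obsX s j))); last first.
  by apply/funext => s; rewrite big_cons.
apply: measurable_maxr => //; rewrite /enorm.
apply: (@measurableT_comp _ _ _ _ _ _ (@Num.sqrt R)).
  by apply: continuous_measurable_fun; exact: sqrt_continuous.
rewrite /dotp; apply: measurable_sum => j.
by apply: measurable_funM; exact: measurable_obsX.
Qed.

Lemma measurable_feature i x : measurable_fun setT (fun s => feature s i x).
Proof.
case: x => [j|[]] /=; apply: measurable_funM;
  [exact: measurable_obsY|exact: measurable_obsX|exact: measurable_obsY| | |];
  by [exact: measurable_max_norm|].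
Qed.

Lemma measurable_pattern h (c : code h) i : measurable [set s | pattern s c i].
Proof.
rewrite -[X in measurable X]setTI.
suff : measurable_fun setT (fun s => pattern s c i).
  by move=> /(_ measurableT [set true]); apply.
case: c => [b|t] /=.
  apply: (@measurableT_comp _ _ _ _ _ _ (fun y : bool => y == b)) => //.
  apply: (@measurableT_comp _ _ _ _ _ _ snd) => //.
  exact: measurable_tnth.
apply: measurable_fun_ler => //; apply: measurable_sum => x.
apply: measurable_funM; last exact: measurable_feature.
apply: measurable_sum => -[[j b]|] //=.
by apply: measurable_funM => //; exact: measurable_feature.
Qed.

(** Patterns take finitely many values, so no regularity of [Q] is asked for.
    Uncountably many classifiers are thus replaced by finitely many measurable
    patterns. *)
Lemma measurable_pattern_event h (Q : ('I_(k.+1 * N) -> bool) -> Prop)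
    (c : code h) :
  measurable [set s | Q (pattern s c)].
Proof.
have -> : [set s | Q (pattern s c)] =
    \bigcup_(p in [set p : {ffun 'I_(k.+1 * N) -> bool} | Q p])
      \bigcap_(i in [set: 'I_(k.+1 * N)]) [set s | pattern s c i = p i].
  apply/seteqP; split=> [s Qs|s [p Qp pE]] /=.
    exists [ffun i => pattern s c i].
      rewrite /=; suff -> : [ffun i => pattern s c i] = pattern s c :> (_ -> _).
        by [].
      by apply/funext => i; rewrite ffunE.
    by move=> i _ /=; rewrite ffunE.
  by have -> : pattern s c = p by apply/funext => i; exact: pE.
apply: fin_bigcup_measurable => // p _.
apply: fin_bigcap_measurable => // i _.
case: (p i); first exact: measurable_pattern.
rewrite (_ : mkset _ = ~` [set s | pattern s c i]).
  by apply: measurableC; exact: measurable_pattern.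
by apply/seteqP; split=> s /= => [->|/negP/negbTE].
Qed.

End Patterns.

(** * Margin errors are covered by few patterns *)

Section Cover.
Variables (R : realType) (d k N : nat).
Implicit Types (s : sample R d k N) (i : 'I_(k.+1 * N)).
Implicit Types (wb : Rvec R d * R) (h : nat).

Definition misclassified s wb i : bool :=
  (0 <= affine wb (obsX s i)) != (tnth s i).2.

Definition in_margin s wb h i : bool :=
  ((affine wb (obsX s i) * obsY s i)%:E
    <= (4 * max_norm s)%:E * gamma_margin R h)%E.

Lemma dotp_enorm (x : Rvec R d) : dotp x x = enorm x ^+ 2.
Proof. by rewrite sqr_sqrtr//; exact: dprod_ge0. Qed.

Lemma enorm_max_norm s i : enorm (obsX s i) <= max_norm s.
Proof. exact: (le_bigmax _ (fun i => enorm (obsX s i))). Qed.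

Lemma max_norm_ge0 s : 0 <= max_norm s.
Proof. exact: bigmax_ge_id. Qed.

Lemma dotp_max_norm s i wb : Theta wb -> `|dotp wb.1 (obsX s i)| <= max_norm s.
Proof.
move=> w1; rewrite -ler_sqr ?nnegrE ?max_norm_ge0// real_normK ?num_real//.
apply: le_trans (dprod_CauchySchwarz (tnth wb.1) (tnth (obsX s i))) _.
rewrite -[dprod (tnth wb.1) _]/(dotp wb.1 wb.1).
rewrite -[dprod _ _]/(dotp (obsX s i) (obsX s i)) !dotp_enorm w1 expr1n mul1r.
by rewrite ler_sqr ?nnegrE ?max_norm_ge0 ?sqrtr_ge0// enorm_max_norm.
Qed.

Lemma gamma_margin_ge h : (1 < h)%N ->
  ((Num.sqrt h%:R)^-1%:E <= gamma_margin R h)%E.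
Proof.
move=> h1; rewrite /gamma_margin.
have hE := odd_double_half h; have half0 : (0 < h./2)%N by lia.
have half1 : 1 <= (h./2)%:R :> R by rewrite ler1n.
have hR : h%:R = (odd h)%:R + 2 * (h./2)%:R :> R.
  by rewrite -{1}hE natrD -muln2 natrM mulrC.
have inv_sqrt (x y : R) : 0 < x -> x <= y ->
    (((Num.sqrt y)^-1)%:E <= ((Num.sqrt x)^-1)%:E)%E.
  move=> x0 xy; rewrite lee_fin lef_pV2 ?posrE ?sqrtr_gt0//.
    by rewrite ler_wsqrtr.
  exact: lt_le_trans xy.
case: (odd h) hR => /= hR.
  rewrite (negbTE (lt0n_neq0 half0)); apply: inv_sqrt.
    rewrite mulr_gt0//; first by rewrite mulr_gt0//; lra.
    have sq1 : 1 < (2 * (h./2)%:R + 1) ^+ 2 :> R by rewrite expr2; nra.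
    by rewrite subr_gt0 ltr_pdivrMr ?mul1r//; lra.
  rewrite hR; have : 0 <= 1 / (2 * (h./2)%:R + 1) ^+ 2 :> R.
    by rewrite divr_ge0 ?sqr_ge0.
  by nra.
by apply: inv_sqrt; rewrite ?hR; lra.
Qed.

Lemma gamma_margin_ge0 h : (0 <= gamma_margin R h)%E.
Proof.
by rewrite /gamma_margin; case: ifP => _; [case: ifP => _|];
  rewrite ?lee_fin ?invr_ge0 ?sqrtr_ge0 ?leey.
Qed.

Lemma misclassified_le0 s wb i :
  misclassified s wb i -> affine wb (obsX s i) * obsY s i <= 0.
Proof.
rewrite /misclassified /obsY /sgn_label; case: (tnth s i).2 => /=.
  by rewrite eqb_id mulr1 -ltNge => /ltW.
by rewrite eqbF_neg negbK mulrN1 oppr_le0.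
Qed.

Lemma misclassified_in_margin s wb h i :
  misclassified s wb i -> in_margin s wb h i.
Proof.
move=> /misclassified_le0 le0; apply: (@le_trans _ _ 0%E); first by rewrite lee_fin.
by apply: mule_ge0 (gamma_margin_ge0 h); rewrite lee_fin mulr_ge0 ?max_norm_ge0.
Qed.

Lemma dprod_sum (D1 D2 : finType) (u v : D1 + D2 -> R) :
  dprod u v = dprod (u \o inl) (v \o inl) + dprod (u \o inr) (v \o inr).
Proof. by rewrite /dprod big_sumType. Qed.

(** Three regimes.  If the classifier is constant on the sample, one of the two
    extra codes reproduces its errors.  If [h = 1] and [max_norm > 0], every
    point is a margin error and the empty run, whose pattern is constantly
    true, is admissible.  Otherwise the bias is at most [max_norm] in absolute
    value, and the perceptron applies to the features. *)
Lemma pattern_cover s wb h : Theta wb -> (0 < h)%N ->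
  exists c : code k N h, forall i,
    (misclassified s wb i -> pattern s c i) /\
    (pattern s c i -> in_margin s wb h i).
Proof.
move=> w1 h0.
have const_cover b : (forall i, (0 <= affine wb (obsX s i)) = ~~ b) ->
    exists c : code k N h, forall i,
    (misclassified s wb i -> pattern s c i) /\
    (pattern s c i -> in_margin s wb h i).
  move=> gb; exists (inl b) => i /=.
  have <- : misclassified s wb i = ((tnth s i).2 == b).
    by rewrite /misclassified gb; case: (b) (tnth s i).2 => -[].
  by split=> //; exact: misclassified_in_margin.
have [allpos|] := pselect (forall i, 0 <= affine wb (obsX s i)).
  by apply: (const_cover false) => i; rewrite allpos.
move=> /existsNP[i1 /negP]; rewrite -ltNge => neg1.
have [allneg|] := pselect (forall i, affine wb (obsX s i) < 0).
  by apply: (const_cover true) => i; rewrite leNgt allneg.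
move=> /existsNP[i2 /negP]; rewrite -leNgt => pos2.
have := dotp_max_norm s i1 w1; have := dotp_max_norm s i2 w1.
rewrite !ler_norml => /andP[_ x2] /andP[x1 _].
set M := max_norm s in x1 x2 *; set b := wb.2.
have {neg1 pos2} [b1 b2] : - M < b /\ b <= M.
  by move: neg1 pos2; rewrite /affine -/b; split; lra.
have M0 : 0 < M by lra.
have [h1|h1] := leqP h 1.
  have {h0 h1}-> : h = 1%N by apply/eqP; rewrite eqn_leq h1.
  exists (inr [tuple None | _ < _]) => i; split=> [_|_].
    rewrite /pattern dprodC dprod_sumr big_tuple big1// => l _.
    by rewrite tnth_mktuple dprod0.
  by rewrite /in_margin /gamma_margin /= gt0_muley ?leey// lte_fin mulr_gt0.
(* [theta] is at most half the margin threshold [4 * M * gamma_margin h].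
   Shifting by [theta] leaves a margin [theta] on both sides: misclassified
   points have shifted margin at most [- theta], points outside the margin at
   least [theta].  The functional [W] is scaled by [M] to avoid dividing the
   bias by it. *)
set theta := 2 * M / Num.sqrt h%:R.
have h2 : 2 <= h%:R :> R by rewrite ler_nat.
have sh0 : 0 < Num.sqrt h%:R :> R by rewrite sqrtr_gt0; lra.
have theta0 : 0 < theta by rewrite divr_gt0// mulr_gt0.
have theta2 : theta ^+ 2 = 4 * M ^+ 2 / h%:R.
  by rewrite !exprMn exprVn sqr_sqrtr; [ring|lra].
pose W (x : 'I_d + bool) : R := match x with
  | inl j => M * tnth wb.1 j
  | inr c => if c then - b else - theta
  end.
have WZ i : dprod W (feature s i)
    = M * (affine wb (obsX s i) * obsY s i - theta).
  rewrite dprod_sum /dprod big_bool /= -/M /affine -/b /dotp.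
  have -> : \sum_(j < d) M * tnth wb.1 j * (obsY s i * tnth (obsX s i) j)
     = M * obsY s i * \sum_(j < d) tnth wb.1 j * tnth (obsX s i) j.
    by rewrite mulr_sumr; apply: eq_bigr => j _; ring.
  by ring.
have WW : dprod W W = M ^+ 2 + b ^+ 2 + theta ^+ 2.
  rewrite dprod_sum /dprod big_bool /=.
  have -> : \sum_(j < d) M * tnth wb.1 j * (M * tnth wb.1 j)
     = M ^+ 2 * dotp wb.1 wb.1.
    by rewrite mulr_sumr; apply: eq_bigr => j _; ring.
  by rewrite dotp_enorm w1; ring.
have y2 i : obsY s i ^+ 2 = 1.
  by rewrite /obsY /sgn_label; case: ifP => _; rewrite ?sqrrN expr1n.
have ZZ i : dprod (feature s i) (feature s i) <= 3 * M ^+ 2.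
  rewrite dprod_sum /dprod big_bool /= -/M.
  have -> : \sum_(j < d) obsY s i * tnth (obsX s i) j
       * (obsY s i * tnth (obsX s i) j) = enorm (obsX s i) ^+ 2.
    rewrite -dotp_enorm -[RHS]mul1r -(y2 i) mulr_sumr.
    by apply: eq_bigr => j _; ring.
  have -> : obsY s i * M * (obsY s i * M) = M ^+ 2.
    by rewrite -[RHS]mul1r -(y2 i); ring.
  have : enorm (obsX s i) ^+ 2 <= M ^+ 2.
    by rewrite ler_sqr ?nnegrE ?sqrtr_ge0 ?enorm_max_norm// ltW.
  by rewrite mul1r -expr2; lra.
have [|i|i||c sc sepc] := @perceptron R _ _ (feature s) W
    (fun i => ~~ in_margin s wb h i) (misclassified s wb) (M * theta)
    (3 * M ^+ 2) (3 * h) _ _ _ ZZ.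
- by rewrite mulr_gt0.
- rewrite /in_margin -ltNge => outi; rewrite WZ ler_pM2l//.
  have : (2 * theta < affine wb (obsX s i) * obsY s i).
    rewrite -lte_fin; apply: le_lt_trans outi.
    have -> : 2 * theta = 4 * M * (Num.sqrt h%:R)^-1 by rewrite /theta; ring.
    rewrite EFinM lee_wpmul2l ?gamma_margin_ge//.
    by rewrite lee_fin mulr_ge0// ltW.
  by lra.
- by move=> /misclassified_le0 le0; rewrite WZ -(mulrN M theta) ler_pM2l//; lra.
(* Novikoff's count: for [h >= 2] the product of square norms is at most
   [(4 * M ^+ 2) * (3 * M ^+ 2)], which is [3 * h] times the square margin. *)
- rewrite WW (exprMn 2 M theta) theta2 natrM.
  have -> : 3 * h%:R * (M ^+ 2 * (4 * M ^+ 2 / h%:R)) = 12 * (M ^+ 2) ^+ 2.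
    by field; lra.
  have bM : b ^+ 2 <= M ^+ 2 by rewrite !expr2; nra.
  have M2 : 0 < M ^+ 2 by rewrite exprn_gt0.
  have hM : 4 * M ^+ 2 / h%:R <= 2 * M ^+ 2.
    by rewrite ler_pdivrMr; nra.
  by nra.
- have sc' : size c == (3 * h)%N by rewrite sc.
  exists (inr (Tuple sc')) => i /=; have [out_sep mis_sep] := sepc i.
  split; first exact: mis_sep.
  by apply: contraTT => /out_sep; rewrite -ltNge.
Qed.

End Cover.

(** * Counting patterns *)

Section Counting.
Variable R : realType.
Implicit Types (k N h : nat) (epsilon : R).

Lemma card_code k N h :
  #|code k N h| = (2 + (k.+1 * N * 2).+1 ^ (3 * h))%N.
Proof.
rewrite /code card_sum card_bool card_tuple card_option card_prod.
by rewrite card_ord card_bool.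
Qed.

(** In the range [h <= n], the logarithm in [complexity] is at least
    [ln (4 e)], hence at least [3 * ln 2]; this is where the length [3 * h] of
    codes is paid for. *)
Lemma complexity_ge k N h epsilon : 0 < epsilon -> (0 < h <= k.+1 * N)%N ->
  (20 * (k.+1 * N)%:R) ^+ (3 * h).+1 * (2 * h%:R * (h%:R + 1) / epsilon)
  <= expR (complexity k N epsilon h).
Proof.
move=> e0 /andP[h0 hn]; rewrite /complexity; set n : R := (k.+1 * N)%:R.
have hR : 0 < h%:R :> R by rewrite ltr0n.
have nh : h%:R <= n by rewrite ler_nat.
have h1 : 1 <= h%:R :> R by rewrite ler1n.
have q0 : 0 < 2 * h%:R * (h%:R + 1) / epsilon.
  by rewrite divr_gt0// !mulr_gt0//; lra.
rewrite expRD lnK ?posrE// ler_pM2r//.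
have n20 : 1 <= 20 * n by lra.
rewrite -[leLHS]lnK ?posrE ?exprn_gt0//; last by lra.
rewrite ler_expR lnXn; last by lra.
rewrite -[_ *+ (3 * h).+1]mulr_natr ler_wpM2l ?ln_ge0//.
rewrite -[(3 * h).+1%:R]natr1 lerD2r natrM.
have ln2 : 0 < ln 2 :> R by rewrite ln_gt0//; lra.
rewrite mulrAC ler_pdivlMr// [leLHS]mulrAC [leRHS]mulrC ler_wpM2r ?(ltW hR)//.
have -> : 3 * ln 2 = ln (2 ^+ 3) :> R by rewrite lnXn// -[RHS]mulr_natl.
rewrite ler_ln ?posrE; last 2 first.
- by rewrite exprn_gt0.
- by rewrite divr_gt0// !mulr_gt0// ?expR_gt0; lra.
rewrite ler_pdivlMr//.
have e2 : 2 <= expR 1 :> R by apply: le_trans (expR_ge1Dx 1); lra.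
have -> : (2 : R) ^+ 3 = 8 by ring.
by nra.
Qed.

Lemma complexity_ge0 k N h epsilon : 0 < epsilon < 1 -> (0 < h <= k.+1 * N)%N ->
  0 <= complexity k N epsilon h.
Proof.
move=> /andP[e0 e1] hh; have /andP[h0 hn] := hh.
rewrite -ler_expR expR0; apply: le_trans (complexity_ge e0 hh).
have h1 : 1 <= h%:R :> R by rewrite ler1n.
have n1 : 1 <= (k.+1 * N)%:R :> R by rewrite ler1n (leq_trans h0).
apply: mulr_ege1; first by rewrite exprn_ege1//; lra.
by rewrite ler_pdivlMr//; nra.
Qed.

Lemma card_code_complexity k N h epsilon :
  0 < epsilon -> (0 < h <= k.+1 * N)%N ->
  #|code k N h|%:R * expR (- complexity k N epsilon h)
  <= epsilon / (h%:R * (h%:R + 1)).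
Proof.
move=> e0 hh; have /andP[h0 hn] := hh.
have := complexity_ge e0 hh; rewrite expRN; set E := expR _.
set n : R := (k.+1 * N)%:R.
have E0 : 0 < E by exact: expR_gt0.
have hR : 0 < h%:R :> R by rewrite ltr0n.
have h1 : 1 <= h%:R :> R by rewrite ler1n.
have n1 : 1 <= n by rewrite ler1n (leq_trans h0).
rewrite ler_pdivrMr//.
have -> : epsilon / (h%:R * (h%:R + 1)) * E
    = 2 * (E / (2 * h%:R * (h%:R + 1) / epsilon)).
  by field; rewrite !lt0r_neq0//; lra.
rewrite -ler_pdivlMr; last by rewrite divr_gt0// !mulr_gt0//; lra.
move=> leE; have /le_trans : #|code k N h|%:R <= 2 * (20 * n) ^+ (3 * h).+1.
  rewrite card_code natrD natrX -[(_ * 2).+1%:R]natr1 natrM -/n.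
  set X := (20 * n) ^+ (3 * h).
  have X1 : 1 <= X by rewrite exprn_ege1//; lra.
  have : (n * 2 + 1) ^+ (3 * h) <= X by rewrite lerXn2r ?nnegrE; lra.
  by rewrite exprS -/X; nra.
by apply; rewrite ler_pM2l.
Qed.

End Counting.

(** * From a pattern to the margin bound *)

Section FromPattern.
Variable R : realType.

(** [m0] and [t0] are the counts of the pattern on the training and the test
    part, [m] the training margin errors and [t] the test errors.  The claim
    is concave in [m]: it holds at [m = m0] by the deviation bound and at
    [m = N] trivially, hence in between. *)
Lemma margin_count_interpolation (N : nat) (a C n m0 m t0 t : R) :
  (0 < N)%N -> 0 < a -> 0 <= C -> 0 < n ->
  0 <= m0 -> m0 <= m -> m <= N%:R -> 0 <= t0 -> t <= t0 -> m0 + t0 <= n ->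
  N%:R + t <= n ->
  expR (- (a * m0)) <= (1 - (1 - expR (- a)) * ((m0 + t0) / n)) ^+ N * expR C ->
  m + t <= n * (1 - expR (- a))^-1 * (1 - expR (- ((a * m + C) / N%:R))).
Proof.
move=> N0 a0 C0 n0 m00 m0m mN t00 tt0 mtn tn dev.
have NR : 0 < N%:R :> R by rewrite ltr0n.
set e := expR (- a) in dev *.
have e1 : 0 < e < 1 by rewrite expR_gt0 -expR0 ltr_expR oppr_lt0.
rewrite mulrAC ler_pdivlMr; last by lra.
pose x (u : R) := - ((a * u + C) / N%:R).
have at_m0 : (m0 + t) * (1 - e) <= n * (1 - expR (x m0)).
  have q0 : 0 <= 1 - (1 - e) * ((m0 + t0) / n).
    have : (m0 + t0) / n <= 1 by rewrite ler_pdivrMr// mul1r.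
    have : 0 <= (m0 + t0) / n by rewrite divr_ge0//; lra.
    by nra.
  have : expR (x m0) <= 1 - (1 - e) * ((m0 + t0) / n).
    rewrite -(@ler_pXn2r _ N) ?nnegrE ?expR_ge0//.
    have -> : expR (x m0) ^+ N = expR (- (a * m0)) * expR (- C).
      rewrite -expRM_natl -expRD /x; congr expR; field; lra.
    by rewrite (expRN C) ler_pdivrMr ?expR_gt0.
  rewrite -(ler_pM2l n0).
  have -> : n * (1 - (1 - e) * ((m0 + t0) / n)) = n - (1 - e) * (m0 + t0).
    by field; lra.
  by nra.
have at_N : (N%:R + t) * (1 - e) <= n * (1 - expR (x N%:R)).
  have : expR (x N%:R) <= e.
    rewrite ler_expR /x lerN2 ler_pdivlMr//; lra.
  by nra.
(* Convexity of the exponential, through its tangent at [x m]. *)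
have tangent u : expR (x m) * (1 + (x u - x m)) <= expR (x u).
  have -> : expR (x u) = expR (x m) * expR (x u - x m).
    by rewrite -expRD; congr expR; ring.
  by rewrite ler_wpM2l ?expR_ge0// expR_ge1Dx.
have xB u : x u - x m = a / N%:R * (m - u) by rewrite /x; field; lra.
have [m0N|m0N] := ltP m0 N%:R; last first.
  by have -> : m = m0 by lra.
rewrite -/(x m).
have lin : (N%:R - m0) * expR (x m)
    <= (N%:R - m) * expR (x m0) + (m - m0) * expR (x N%:R).
  have h1 : (N%:R - m) * (expR (x m) * (1 + (x m0 - x m)))
      <= (N%:R - m) * expR (x m0) by rewrite ler_wpM2l// subr_ge0.
  have h2 : (m - m0) * (expR (x m) * (1 + (x N%:R - x m)))
      <= (m - m0) * expR (x N%:R) by rewrite ler_wpM2l// subr_ge0.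
  apply: le_trans (lerD h1 h2); rewrite !xB le_eqVlt; apply/orP; left.
  by apply/eqP; ring.
rewrite -(@ler_pM2l _ (N%:R - m0)); last by lra.
have h1 : (N%:R - m) * ((m0 + t) * (1 - e))
    <= (N%:R - m) * (n * (1 - expR (x m0))) by rewrite ler_wpM2l// subr_ge0.
have h2 : (m - m0) * ((N%:R + t) * (1 - e))
    <= (m - m0) * (n * (1 - expR (x N%:R))) by rewrite ler_wpM2l// subr_ge0.
have h3 := ler_wpM2l (ltW n0) lin.
by lra.
Qed.

End FromPattern.

(** * The margin bound *)

Section MarginBoundProof.
Variables (R : realType) (d k N : nat).
Hypotheses (N_gt0 : (0 < N)%N) (k_gt0 : (0 < k)%N).
Implicit Types (s : sample R d k N) (wb : Rvec R d * R).

Lemma test_error_le_bound_at epsilon s wb (lambda : R) (h : nat)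
    (p : 'I_(k.+1 * N) -> bool) :
  0 < lambda -> 0 <= complexity k N epsilon h ->
  (forall i, (misclassified s wb i -> p i) /\ (p i -> in_margin s wb h i)) ->
  ~ deviates (complexity k N epsilon h) p ->
  test_error s wb <= bound_at epsilon s wb lambda h.
Proof.
move=> l0 C0 cover ndev; set C := complexity _ _ _ _ in C0 ndev *.
have NR : 0 < N%:R :> R by rewrite ltr0n.
have kR : 0 < k%:R :> R by rewrite ltr0n.
pose t := (\sum_(i < k.+1 * N | (N <= i)%N) misclassified s wb i)%N.
pose t0 := (\sum_(i < k.+1 * N | (N <= i)%N) p i)%N.
pose m := train_count (in_margin s wb h).
have testE : test_error s wb = (k * N)%:R^-1 * t%:R.
  rewrite /test_error /t natr_sum; congr (_ * _); apply: eq_bigr => i _.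
  rewrite /misclassified /obsY /sgn_label; congr (nat_of_bool _)%:R.
  case: (0 <= _); case: (tnth s i).2; apply/eqP => /=; lra.
have marginE : margin_errors s wb h = m%:R by rewrite /m /train_count natr_sum.
have totalE : total_count p = (train_count p + t0)%N.
  rewrite /total_count (bigID (fun i : 'I_(k.+1 * N) => (i < N)%N)) /=.
  by congr (_ + _)%N; apply: eq_bigl => i; rewrite -leqNgt.
have n_card : (\sum_(i < k.+1 * N | (i < N)%N) 1 = N)%N.
  by rewrite sum_block0 sum1_card card_ord.
have n_card' : (N + \sum_(i < k.+1 * N | (N <= i)%N) 1 = k.+1 * N)%N.
  rewrite -{1}n_card -[RHS]card_ord -sum1_card.
  rewrite [RHS](bigID (fun i : 'I_(k.+1 * N) => (i < N)%N)) /=.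
  by congr (_ + _)%N; apply: eq_bigl => i; rewrite -leqNgt.
have mis_p i : (misclassified s wb i <= p i)%N.
  by have [+ _] := cover i; case: misclassified => // /(_ isT)->.
have p_mar i : (p i <= in_margin s wb h i)%N.
  by have [_ +] := cover i; case: (p i) => // /(_ isT)->.
have ndev' : expR (- (lambda / N%:R * (train_count p)%:R))
    <= mean_laplace (lambda / N%:R) p ^+ N * expR C.
  rewrite leNgt; apply/negP => dev; apply: ndev.
  by exists (lambda / N%:R) => //; exact: divr_gt0.
have := @margin_count_interpolation R N (lambda / N%:R) C (k.+1 * N)%:R
  (train_count p)%:R m%:R t0%:R t%:R N_gt0.
rewrite -[(train_count p)%:R + t0%:R]natrD -totalE -/(mean_laplace _ _).
rewrite !ler_nat => /(_ (divr_gt0 l0 NR) C0).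
move=> interp; rewrite testE /bound_at marginE -/C.
have {}interp : m%:R + t%:R <= (k.+1 * N)%:R * (1 - expR (- (lambda / N%:R)))^-1
    * (1 - expR (- ((lambda / N%:R * m%:R + C) / N%:R))) :> R.
  apply: interp => //.
  - by rewrite ltr0n muln_gt0.
  - exact: leq_sum.
  - rewrite -[leqRHS]n_card; apply: leq_sum => i _; exact: leq_b1.
  - exact: leq_sum.
  - rewrite -[leqRHS]card_ord -sum1_card; apply: leq_sum => i _; exact: leq_b1.
  - rewrite -natrD ler_nat -[leqRHS]n_card' leq_add2l.
    by apply: leq_sum => i _; exact: leq_b1.
have kN : 0 < (k * N)%:R :> R by rewrite ltr0n muln_gt0 k_gt0.
rewrite lerBrDr -mulrDr addrC mulrC ler_pdivrMr//.
apply: le_trans interp _; rewrite le_eqVlt; apply/orP; left; apply/eqP.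
have -> : - (lambda / N%:R ^+ 2 * m%:R) - C / N%:R
    = - ((lambda / N%:R * m%:R + C) / N%:R) by field; lra.
by rewrite !natrM; set E1 := (1 - _)^-1; field; lra.
Qed.

Definition bad_event (epsilon : R) h : set (sample R d k N) :=
  [set s | exists c : code k N h,
    deviates (complexity k N epsilon h) (pattern s c)].

Lemma measurable_bad_event epsilon h : measurable (bad_event epsilon h).
Proof.
have -> : bad_event epsilon h = \bigcup_(c in [set: code k N h])
    [set s | deviates (complexity k N epsilon h) (pattern s c)].
  by apply/seteqP; split=> s /= [c] => [|_] ?; exists c.
apply: fin_bigcup_measurable => // c _.
exact: measurable_pattern_event.
Qed.

Variable P : probability (sample R d k N) R.
Hypothesis P_exch : partially_exchangeable P.

(** Relabelling codes along each rotation turns the patterns of the rotated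
    sample into rotated patterns of the original one, so that the union bound
    runs over codes with a fixed pattern for each. *)
Lemma bad_event_prob epsilon h : 0 < epsilon -> (0 < h <= k.+1 * N)%N ->
  (P (bad_event epsilon h) <= (epsilon / (h%:R * (h%:R + 1)))%:E)%E.
Proof.
move=> e0 hh; set C := complexity k N epsilon h.
apply: (@le_trans _ _ (#|code k N h|%:R * expR (- C))%:E); last first.
  by rewrite lee_fin card_code_complexity.
apply: orbit_fraction_bound => // [|s]; first exact: measurable_bad_event.
pose dev (c : code k N h) :=
  [pred g | `[< deviates C (pattern s c \o rotate g) >]].
apply: (@le_trans _ _ (\sum_(c : code k N h) #|dev c|)%N%:R).
  rewrite ler_nat -sum1_card big_mkcond /=.
  under [leqRHS]eq_bigr do rewrite -sum1_card big_mkcond /=.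
  rewrite exchange_big /=; apply: leq_sum => g _.
  case: ifPn => // /asboolP[c devc].
  rewrite (bigD1 (relabel (rotate g) c)) //=.
  have -> : g \in dev (relabel (rotate g) c).
    apply/asboolP; suff <- : pattern (permute (rotate g) s) c
      = pattern s (relabel (rotate g) c) \o rotate g by [].
    by apply/funext => i; apply: pattern_permute; exact: rotate_bij.
  by rewrite leq_addr.
rewrite natr_sum -mulrA mulr_natl -sumr_const; apply: ler_sum => c _.
exact: rotation_deviation.
Qed.

Lemma bad_events_prob epsilon n : 0 < epsilon -> (n <= k.+1 * N)%N ->
  (P (\big[setU/set0]_(h < n) bad_event epsilon h.+1)
    <= (epsilon * (1 - n.+1%:R^-1))%:E)%E.
Proof.
move=> e0; elim: n => [|n IH] hn.
  by rewrite big_ord0 measure0 invr1 subrr mulr0.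
rewrite big_ord_recr /=.
(* The weights [1 / (h (h + 1))] telescope. *)
have -> : (epsilon * (1 - n.+2%:R^-1))%:E
    = ((epsilon * (1 - n.+1%:R^-1))%:E
      + (epsilon / (n.+1%:R * (n.+1%:R + 1)))%:E)%E.
  rewrite -EFinD -[n.+2%:R]natr1; congr (_%:E).
  have n0 : 0 < n.+1%:R :> R by rewrite ltr0n.
  by field; rewrite !lt0r_neq0//; lra.
apply: (@le_trans _ _ (P (\big[setU/set0]_(h < n) bad_event epsilon h.+1)
    + P (bad_event epsilon n.+1))%E).
  apply: measureU2; last exact: measurable_bad_event.
  by apply: bigsetU_measurable => h _; exact: measurable_bad_event.
by apply: leeD; [exact/IH/ltnW|exact: bad_event_prob].
Qed.

End MarginBoundProof.

Theorem theorem3p19 (R : realType) (N k d : nat)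
    (hN : (0 < N)%N) (hk : (0 < k)%N) (hd : (0 < d)%N)
    (epsilon : R) (heps : 0 < epsilon < 1)
    (P : probability (sample R d k N) R)
    (hP : partially_exchangeable P) :
  with_prob_ge P (1 - epsilon)
    [set s : sample R d k N | forall wb : Rvec R d * R, Theta wb ->
      ((test_error s wb)%:E <= margin_bound epsilon s wb)%E].
Proof.
have /andP[e0 e1] := heps.
pose B := \big[setU/set0]_(h < k.+1 * N) @bad_event R d k N epsilon h.+1.
have mB : measurable B.
  by apply: bigsetU_measurable => h _; exact: measurable_bad_event.
exists (~` B); split; first exact: measurableC.
- move=> s goods wb w1; apply: le_ereal_inf_tmp => _ [lambda [h [l0 hh ->]]].
  have /andP[h0 hn] := hh; rewrite lee_fin.
  have [c cover] := pattern_cover s w1 h0.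
  apply: (test_error_le_bound_at hN hk l0 (complexity_ge0 heps hh) cover) => dev.
  apply: goods; rewrite /B -(bigcup_mkord _ (fun h => bad_event epsilon h.+1)).
  exists h.-1 => /=.
    by rewrite prednK.
  by rewrite prednK//; exists c.
- rewrite probability_setC// EFinB leeB//.
  apply: le_trans (bad_events_prob hN hP e0 (leqnn _)) _.
  by rewrite lee_fin ler_piMr ?(ltW e0)// gerBl invr_ge0.
Qed.
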